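(* For each odd prime $p$ and positive integers $m$, $n$ and $d$ with $1\le d\le n\le m$ there exists a local nearring $R$ whose additive group $R^+$ is isomorphic to the group $G(p^m,p^n,p^d)$.
   Context: For an odd prime $p$ and integers $1\le d\le n\le m$, $G(p^m,p^n,p^d)$ denotes the group $\langle a,b,c\mid a^{p^m}=b^{p^n}=c^{p^d}=1,\ a^b=ac,\ c^a=c^b=c\rangle$, where $x^y=y^{-1}xy$; it has order $p^{m+n+d}$. A nearring here is a left distributive nearring with a multiplicative identity: a set $R$ with operations $+,\cdot$ such that $(R,+)=R^+$ is a (not necessarily abelian) group, $(R,\cdot)$ is a monoid, and $x(y+z)=xy+xz$ for all $x,y,z\in R$. Such a nearring is called local if the set of all non-invertible elements of the monoid $(R,\cdot)$ is a subgroup of $R^+$. *)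

(* Defs.v *)
From mathcomp Require Import all_boot all_fingroup.

Set Implicit Arguments.
Unset Strict Implicit.
Unset Printing Implicit Defensive.

Local Open Scope group_scope.

(* A left distributive nearring with identity whose additive group is [T].
   Since [T] need not be abelian, its law is written multiplicatively: [x * y]
   below is the nearring sum x + y, [nr_mul] is the nearring product.  Neither
   0 x = 0 nor 0 <> 1 is required. *)
Record nearring (T : groupType) := Nearring {
  nr_mul : T -> T -> T;
  nr_one : T;
  nr_mulA : associative nr_mul;
  nr_mul1x : left_id nr_one nr_mul;
  nr_mulx1 : right_id nr_one nr_mul;
  nr_mulDr : forall x y z, nr_mul x (y * z) = nr_mul x y * nr_mul x z
}.

Definition nr_invertible (T : groupType) (R : nearring T) (x : T) : Prop :=
  exists y, nr_mul R x y = nr_one R /\ nr_mul R y x = nr_one R.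

Definition nr_local (T : groupType) (R : nearring T) : Prop :=
  exists S : {pred T},
    group_closed S /\ forall x, x \in S <-> ~ nr_invertible R x.

(* [Presentation.iso] describes the largest finite quotient of the presented
   group; here the presented group is finite (a and b have finite order modulo
   the finite central subgroup <c> containing their commutator), so this is
   isomorphism with the presented group itself. *)
Definition isog_Gpmnd (gT : finGroupType) (G : {group gT}) (p m n d : nat) :=
  G \isog Grp (a : b : c :
    a ^+ (p ^ m)%N, b ^+ (p ^ n)%N, c ^+ (p ^ d)%N,
    a ^ b = a * c, c ^ a = c, c ^ b = c).

(* Main.v *)
Require Import Defs.
From HB Require Import structures.
From mathcomp Require Import all_boot all_fingroup.
From mathcomp Require Import all_algebra commutator ring.

(** Write the elements of G = G(p^m, p^n, p^d) as words a^i b^j c^k with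
    c = [a, b] central.  A left distributive nearring on G with identity e
    amounts to a monoid of endomorphisms of G in which exactly one element,
    L_x, sends e to a given x; the product of x and y is then L_x(y).
    The choice made here is e = a, with

      L_x : a |-> x,   b |-> b^t,   c |-> c^(t^2),

    where t is the exponent of a in x.  Reading t modulo p^n and p^d makes
    sense because d <= n <= m.  As t is multiplicative, L_x o L_y and
    L_(L_x(y)) agree on generators, whence associativity.  Moreover x is
    invertible exactly when t is a unit modulo p^m, and x |-> t is a
    homomorphism from G to the local ring Z/p^m, so the non-invertible elements
    form a subgroup.

    The computations become linear in symmetric (Baer, or Lie ring)
    coordinates: since p is odd, 2 has an inverse h in Z/p^d and G is the set
    Z/p^m x Z/p^n x Z/p^d with the
    group law

      (x, y) |-> x + y + h (0, 0, x1 y2 - x2 y1).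

    In these coordinates L_x is the linear map

      y |-> (x1 y1, x2 y1 + x1 y2, x3 y1 + x1^2 y3),

    which multiplies the bracket x1 y2 - x2 y1 by x1^2.  All nearring axioms
    are then polynomial identities, and they hold for any chain of commutative
    rings A -> B -> C in place of Z/p^m -> Z/p^n -> Z/p^d ([heis_nearring],
    [heis_local]).  The presentation of this group is checked for any chain of
    moduli s | r | q with 2 invertible modulo s ([heis_isoGrp]). *)

Set Implicit Arguments.
Unset Strict Implicit.
Unset Printing Implicit Defensive.

Import GRing.Theory.

Local Open Scope ring_scope.

(** * Heisenberg groups in symmetric coordinates *)

(** The carrier is a plain product; the morphisms and the scalar [h] are
    recorded in the type so that they determine the group law put on it. *)
Definition heis (A B C : finComNzRingType) (f : {rmorphism A -> B})
  (g : {rmorphism B -> C}) (h : C) := (A * B * C)%type.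

HB.instance Definition _ A B C f g h := Finite.on (@heis A B C f g h).

Lemma heis_eq (A B C : finComNzRingType) (f : {rmorphism A -> B})
    (g : {rmorphism B -> C}) (h : C) (x y : heis f g h) :
  x.1.1 = y.1.1 -> x.1.2 = y.1.2 -> x.2 = y.2 -> x = y.
Proof. by case: x y => [[? ?] ?] [[? ?] ?] /= -> -> ->. Qed.

Section HeisGroup.

Variables (A B C : finComNzRingType).
Variables (f : {rmorphism A -> B}) (g : {rmorphism B -> C}) (h : C).
Local Notation H := (heis f g h).
Implicit Types x y z : H.

Definition heis_bracket x y : C := g (f x.1.1 * y.1.2 - x.1.2 * f y.1.1).

Definition heis_add x y : H :=
  (x.1.1 + y.1.1, x.1.2 + y.1.2, x.2 + y.2 + h * heis_bracket x y).

Definition heis_opp x : H := (- x.1.1, - x.1.2, - x.2).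

Fact heis_addA : associative heis_add.
Proof. by move=> x y z; apply: heis_eq; rewrite /= /heis_bracket /=; ring. Qed.

Fact heis_add0x : left_id ((0, 0, 0) : H) heis_add.
Proof. by move=> x; apply: heis_eq; rewrite /= /heis_bracket /=; ring. Qed.

Fact heis_addx0 : right_id ((0, 0, 0) : H) heis_add.
Proof. by move=> x; apply: heis_eq; rewrite /= /heis_bracket /=; ring. Qed.

Fact heis_addNx : left_inverse ((0, 0, 0) : H) heis_opp heis_add.
Proof. by move=> x; apply: heis_eq; rewrite /= /heis_bracket /=; ring. Qed.

Fact heis_addxN : right_inverse ((0, 0, 0) : H) heis_opp heis_add.
Proof. by move=> x; apply: heis_eq; rewrite /= /heis_bracket /=; ring. Qed.

HB.instance Definition _ := isGroup.Build H
  heis_addA heis_add0x heis_addx0 heis_addNx heis_addxN.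

Lemma heis_mulgE x y : (x * y)%g = heis_add x y. Proof. by []. Qed.

(** The bracket of [x] with a multiple of itself vanishes, so powers are
    computed coordinatewise: this is what symmetric coordinates are for. *)
Lemma heis_expgE x k : (x ^+ k)%g = (x.1.1 *+ k, x.1.2 *+ k, x.2 *+ k) :> H.
Proof.
elim: k => [|k IH]; first by rewrite expg0; apply: heis_eq.
rewrite expgS IH heis_mulgE.
by apply: heis_eq; rewrite /= /heis_bracket /=; ring.
Qed.

Lemma heis_conjgE x y :
  (x ^ y)%g = (x.1.1, x.1.2, x.2 + (h *+ 2) * heis_bracket x y) :> H.
Proof. by apply: heis_eq; rewrite /= /heis_bracket /=; ring. Qed.

(** * The nearring product and its units *)

(** [heis_mul x] is the linear map sending (1, 0, 0) to [x] and scaling the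
    other two axes by the first coordinate of [x] and by its square; the square
    is forced by compatibility with the bracket. *)
Definition heis_mul x y : H :=
  (x.1.1 * y.1.1, x.1.2 * f y.1.1 + f x.1.1 * y.1.2,
   x.2 * g (f y.1.1) + g (f x.1.1) ^+ 2 * y.2).

Fact heis_mulA : associative heis_mul.
Proof. by move=> x y z; apply: heis_eq => /=; ring. Qed.

Fact heis_mul1x : left_id ((1, 0, 0) : H) heis_mul.
Proof. by move=> x; apply: heis_eq => /=; ring. Qed.

Fact heis_mulx1 : right_id ((1, 0, 0) : H) heis_mul.
Proof. by move=> x; apply: heis_eq => /=; ring. Qed.

Fact heis_mulDr x y z :
  heis_mul x (y * z)%g = (heis_mul x y * heis_mul x z)%g.
Proof.
by rewrite !heis_mulgE; apply: heis_eq; rewrite /= /heis_bracket /=; ring.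
Qed.

Definition heis_nearring : nearring H :=
  Nearring heis_mulA heis_mul1x heis_mulx1 heis_mulDr.

End HeisGroup.

(** The matrix of [heis_mul x] is triangular with diagonal [t], [t], [t ^+ 2],
    where [t] is the first coordinate of [x]. *)
Lemma heis_invertibleP (A : finComUnitRingType) (B C : finComNzRingType)
    (f : {rmorphism A -> B}) (g : {rmorphism B -> C}) (h : C)
    (x : heis f g h) :
  nr_invertible (heis_nearring f g h) x <-> x.1.1 \is a GRing.unit.
Proof.
split=> [[y []] /(congr1 (fun z : heis f g h => z.1.1)) /= xy1 _|Ux].
  by apply/unitrPr; exists y.1.1.
set u := (x.1.1)^-1.
have ux : x.1.1 * u = 1 by rewrite mulrV.
have fux : f x.1.1 * f u = 1 by rewrite -rmorphM ux rmorph1.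
have gux : g (f x.1.1) * g (f u) = 1 by rewrite -rmorphM fux rmorph1.
exists (u, - (x.1.2 * f u ^+ 2), - (x.2 * g (f u) ^+ 3)).
split; apply: heis_eq => //=.
- by ring: fux.
- by ring: gux.
- by rewrite mulrC.
- by ring: fux.
- by ring: gux.
Qed.

(** The first coordinate is a group homomorphism, so the non-units of [A] pull
    back to a subgroup. *)
Lemma heis_local (A : finComUnitRingType) (B C : finComNzRingType)
    (f : {rmorphism A -> B}) (g : {rmorphism B -> C}) (h : C) :
  zmod_closed [pred u : A | u \isn't a GRing.unit] ->
  nr_local (heis_nearring f g h).
Proof.
move=> [n0 nB].
pose S : {pred heis f g h} := fun x => x.1.1 \isn't a GRing.unit.
exists S; split.
  split=> [|x y nx ny]; first exact: n0.
  exact: (nB x.1.1 y.1.1).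
by move=> x; rewrite heis_invertibleP; split=> /negP.
Qed.

(** * Residue rings of integers *)

Section ZpProj.

Variables (q r : nat).

(** The proofs are arguments so that the morphism structure can be attached to
    the function: reduction is a ring morphism only when [r] divides [q], and
    ['Z_q] has characteristic [q] only when [q] exceeds 1. *)
Definition Zp_proj of (1 < q)%N & (1 < r)%N & (r %| q)%N :=
  fun x : 'Z_q => x%:R : 'Z_r.

Hypotheses (q_gt1 : (1 < q)%N) (r_gt1 : (1 < r)%N) (r_dv_q : (r %| q)%N).

Lemma Zp_proj_nat k : Zp_proj q_gt1 r_gt1 r_dv_q k%:R = k%:R.
Proof.
by apply: val_inj; rewrite /Zp_proj /= !val_Zp_nat // modn_dvdm.
Qed.

Fact Zp_proj_nmod : nmod_morphism (Zp_proj q_gt1 r_gt1 r_dv_q).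
Proof.
split=> [|x y]; first exact: (Zp_proj_nat 0).
by rewrite -(natr_Zp x) -(natr_Zp y) -natrD !Zp_proj_nat natrD.
Qed.

Fact Zp_proj_monoid : monoid_morphism (Zp_proj q_gt1 r_gt1 r_dv_q).
Proof.
split=> [|x y]; first exact: (Zp_proj_nat 1).
by rewrite -(natr_Zp x) -(natr_Zp y) -natrM !Zp_proj_nat natrM.
Qed.

HB.instance Definition _ :=
  GRing.isNmodMorphism.Build ('Z_q) ('Z_r) (Zp_proj q_gt1 r_gt1 r_dv_q)
    Zp_proj_nmod.
HB.instance Definition _ :=
  GRing.isMonoidMorphism.Build ('Z_q) ('Z_r) (Zp_proj q_gt1 r_gt1 r_dv_q)
    Zp_proj_monoid.

End ZpProj.

Lemma Zp_half s : (1 < s)%N -> odd s -> exists h : 'Z_s, h *+ 2 = 1.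
Proof.
move=> s_gt1 s_odd; exists (2%:R)^-1.
by rewrite -[LHS]mulr_natr mulVr // unitZpE // coprimen2.
Qed.

(** The non-units modulo p^m are the kernel of reduction modulo p. *)
Lemma Zp_pexp_nonunit_zmod p m : prime p -> (0 < m)%N ->
  zmod_closed [pred u : 'Z_(p ^ m) | u \isn't a GRing.unit].
Proof.
move=> p_pr m_gt0; have p_gt1 := prime_gt1 p_pr.
have pm_gt1 : (1 < p ^ m)%N by rewrite -(exp1n m) ltn_exp2r.
have p_dv_pm : (p %| p ^ m)%N by rewrite dvdn_exp.
have nonunitE (u : 'Z_(p ^ m)) :
    (u \isn't a GRing.unit) = (Zp_proj pm_gt1 p_gt1 p_dv_pm u == 0).
  rewrite -{1}(natr_Zp u) unitZpE // coprime_pexpl // prime_coprime // negbK.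
  by rewrite -val_eqE /= val_Zp_nat.
split=> [|u v]; rewrite !inE !nonunitE ?rmorph0 // => /eqP u0 /eqP v0.
by rewrite rmorphB /= u0 v0 subrr.
Qed.

Section ZpExp.

Variables (gT : finGroupType) (n : nat) (x : gT).
Hypotheses (n_gt1 : (1 < n)%N) (xn1 : (x ^+ n = 1)%g).

Lemma expg_Zp_nat k : (x ^+ (k%:R : 'Z_n) = x ^+ k)%g.
Proof. by rewrite val_Zp_nat // expg_mod. Qed.

Lemma expg_ZpD (i j : 'Z_n) : (x ^+ (i + j)%R = x ^+ i * x ^+ j)%g.
Proof. by rewrite -{1}(natr_Zp i) -{1}(natr_Zp j) -natrD expg_Zp_nat expgD. Qed.

End ZpExp.

(** * The presentation *)

Lemma mem_join_cycles (gT : finGroupType) (x y z : gT) i j k :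
  (x ^+ i * y ^+ j * z ^+ k \in <[x]> <*> <[y]> <*> <[z]>)%g.
Proof.
have sub_xy := joing_subl (<[x]> <*> <[y]>)%g <[z]>%g.
rewrite !groupM // groupX // -cycle_subG ?joing_subr //.
  exact: subset_trans (joing_subl _ _) sub_xy.
exact: subset_trans (joing_subr _ _) sub_xy.
Qed.

(** Worth stating for an abstract group: on a concrete one, simplifying the
    presentation would unfold the group law as well. *)
Lemma homGrpP (gT : finGroupType) (G : {group gT}) (q r s : nat) :
  reflect (exists x y z, [/\ (<[x]> <*> <[y]> <*> <[z]> = G)%g,
             [/\ x ^+ q = 1, y ^+ r = 1 & z ^+ s = 1]%g
           & [/\ x ^ y = x * z, z ^ x = z & z ^ y = z]%g])
          (G \homg Grp (a : b : c : a ^+ q, b ^+ r, c ^+ s,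
                         a ^ b = a * c, c ^ a = c, c ^ b = c))%g.
Proof.
apply: (iffP existsP) => [[[[x y] z]] |]; last first.
  case=> x [y [z [defG [xq yr zs] [xy zx zy]]]].
  by exists (x, y, z); rewrite /= defG xq yr zs xy zx zy eqxx.
rewrite /= !xpair_eqE => /and5P[/eqP defG /eqP xq /eqP yr /eqP zs].
by case/and3P=> /eqP xy /eqP zx /eqP zy; exists x, y, z.
Qed.

Section Presentation.

Variables (q r s : nat).
Hypotheses (q_gt1 : (1 < q)%N) (r_gt1 : (1 < r)%N) (s_gt1 : (1 < s)%N).
Hypotheses (r_dv_q : (r %| q)%N) (s_dv_r : (s %| r)%N).
Variable h : 'Z_s.
Hypothesis h2 : h *+ 2 = 1.

Local Notation f := (Zp_proj q_gt1 r_gt1 r_dv_q).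
Local Notation g := (Zp_proj r_gt1 s_gt1 s_dv_r).
Local Notation H := (heis f g h).

Let a : H := (1, 0, 0).
Let b : H := (0, 1, 0).
Let c : H := (0, 0, 1).

(** The correction [h * g (f i * j)] converts between symmetric coordinates and
    exponents: a^i b^j has symmetric coordinates (i, j, h i j). *)
Lemma heis_normal_form (u : H) :
  u = (a ^+ u.1.1 * b ^+ u.1.2 * c ^+ (u.2 - h * g (f u.1.1 * u.1.2))%R)%g.
Proof.
(* [t] is kept opaque, since simplification would unfold its arithmetic. *)
move Dt: (u.2 - _) => t; rewrite !heis_expgE !heis_mulgE.
by apply: heis_eq; rewrite /= /heis_bracket /= ?mul0rn ?natr_Zp -?Dt; ring.
Qed.

Lemma heis_homGrp :
  ([set: H] \homg
    Grp (a : b : c : a ^+ q, b ^+ r, c ^+ s, a ^ b = a * c, c ^ a = c,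
                     c ^ b = c))%g.
Proof.
have Zp0 t : (1 < t)%N -> (1 : 'Z_t) *+ t = 0.
  by move=> t_gt1; rewrite pchar_Zp.
have defH : (<[a]> <*> <[b]> <*> <[c]> = [set: H])%g.
  apply/setP=> u; rewrite inE (heis_normal_form u).
  exact: mem_join_cycles.
have aq : (a ^+ q = 1)%g by rewrite heis_expgE /= Zp0 // !mul0rn.
have br : (b ^+ r = 1)%g by rewrite heis_expgE /= Zp0 // !mul0rn.
have cs : (c ^+ s = 1)%g by rewrite heis_expgE /= Zp0 // !mul0rn.
have ab : (a ^ b = a * c)%g.
  rewrite heis_conjgE heis_mulgE h2.
  by apply: heis_eq; rewrite /= /heis_bracket /=; ring.
have ca : (c ^ a = c)%g.
  by rewrite heis_conjgE; apply: heis_eq; rewrite /= /heis_bracket /=; ring.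
have cb : (c ^ b = c)%g.
  by rewrite heis_conjgE; apply: heis_eq; rewrite /= /heis_bracket /=; ring.
by apply/homGrpP; exists a, b, c.
Qed.

(** Sending the normal form of [u] to the same word in the generators of [K] is
    multiplicative: collecting words in [K] uses only the relations, and yields
    the law of the Heisenberg group because 2 [h] = 1. *)
Lemma heis_universal (rT : finGroupType) (K : {group rT}) :
  (K \homg
    Grp (a : b : c : a ^+ q, b ^+ r, c ^+ s, a ^ b = a * c, c ^ a = c,
                     c ^ b = c) ->
  K \homg [set: H])%g.
Proof.
case/homGrpP=> x [y [z [defK [xq yr zs] [xy zx zy]]]].
have czx : commute z x by apply/commgP/conjg_fixP.
have czy : commute z y by apply/commgP/conjg_fixP.
have def_z : [~ x, y]%g = z by rewrite commgEl xy mulKg.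
have swap (i : 'Z_r) (j : 'Z_q) :
    (y ^+ i * x ^+ j = x ^+ j * y ^+ i * z ^+ (- g (f j * i))%R)%g.
  have E : (z ^+ (g (f j * i))%R = [~ x ^+ j, y ^+ i])%g.
    rewrite commXXg def_z; try exact: commute_sym.
    rewrite -[X in _ = (z ^+ X)%g]/(j * i)%N.
    rewrite -(expg_Zp_nat s_gt1 zs (j * i)) natrM rmorphM.
    congr (z ^+ (nat_of_ord (_ * _)%R))%g.
    exact: Zp_proj_nat.
  by rewrite (commgC (x ^+ j)%g) -E -mulgA -expg_ZpD // subrr expg0 mulg1.
(* Collection to the left: only moving y^j past x^i' costs a power of z. *)
have mul_nf (i i' : 'Z_q) (j j' : 'Z_r) (k k' : 'Z_s) :
    (x ^+ i * y ^+ j * z ^+ k * (x ^+ i' * y ^+ j' * z ^+ k')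
     = x ^+ (i + i')%R * y ^+ (j + j')%R * z ^+ (k + k' - g (f i' * j))%R)%g.
  have cz t l : commute (z ^+ t)%g (y ^+ l)%g by apply: commuteX2.
  have czxy : commute (z ^+ k)%g (x ^+ i' * y ^+ j')%g.
    by apply: commuteM; [apply: commuteX2 | apply: cz].
  rewrite !expg_ZpD //.
  rewrite mulgA -[(_ * z ^+ k * _)%g]mulgA czxy !mulgA.
  rewrite -[(x ^+ i * y ^+ j * _)%g]mulgA swap.
  rewrite -!mulgA; do 3 congr (_ * _)%g.
  rewrite [LHS]mulgA cz -!mulgA; congr (_ * _)%g.
  by rewrite -!expg_ZpD //; congr (z ^+ _)%g; congr nat_of_ord; ring.
pose nf (i : 'Z_q) (j : 'Z_r) (k : 'Z_s) := (x ^+ i * y ^+ j * z ^+ k)%g.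
pose phi (u : H) := nf u.1.1 u.1.2 (u.2 - h * g (f u.1.1 * u.1.2)).
have phiM : {in setT &, {morph phi : u v / (u * v)%g}}.
  move=> u v _ _; rewrite /phi /nf mul_nf; congr (_ * z ^+ _)%g.
  congr nat_of_ord; rewrite /= /heis_bracket.
  (* The term left by collection is twice [h] times itself, the two halves
     coming from the bracket and from the change of coordinates. *)
  by rewrite -[g (f v.1.1 * u.1.2)]mul1r -h2; ring.
apply/homgP; exists (Morphism phiM); apply/eqP; rewrite eqEsubset -defK.
apply/andP; split.
  apply/subsetP=> w /morphimP[u _ _ ->].
  exact: mem_join_cycles.
have nf_im i j k : nf i j k \in (Morphism phiM @* [set: H])%g.
  have -> : nf i j k = Morphism phiM ((i, j, k + h * g (f i * j)) : H).
    by rewrite /= /phi /= addrK.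
  by rewrite mem_morphim ?inE.
have x_nf : x = nf 1 0 0
  by rewrite /nf !expg0 !mulg1 -{1}(expg_Zp_nat q_gt1 xq 1).
have y_nf : y = nf 0 1 0
  by rewrite /nf !expg0 mul1g mulg1 -{1}(expg_Zp_nat r_gt1 yr 1).
have z_nf : z = nf 0 0 1
  by rewrite /nf !expg0 !mul1g -{1}(expg_Zp_nat s_gt1 zs 1).
by rewrite !join_subG !cycle_subG x_nf y_nf z_nf !nf_im.
Qed.

Lemma heis_isoGrp :
  ([set: H] \isog
    Grp (a : b : c : a ^+ q, b ^+ r, c ^+ s, a ^ b = a * c, c ^ a = c,
                     c ^ b = c))%g.
Proof. exact: intro_isoGrp heis_homGrp heis_universal. Qed.

End Presentation.

Local Close Scope ring_scope.

Theorem theorem3 (p m n d : nat) (p_prime : prime p) (p_odd : odd p)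
    (d_gt0 : 1 <= d) (le_dn : d <= n) (le_nm : n <= m) :
  exists (gT : finGroupType) (R : nearring gT),
    nr_local R /\ isog_Gpmnd [set: gT]%G p m n d.
Proof.
have p_gt1 := prime_gt1 p_prime.
have n_gt0 := leq_trans d_gt0 le_dn; have m_gt0 := leq_trans n_gt0 le_nm.
have pX_gt1 k : (0 < k)%N -> (1 < p ^ k)%N.
  by move=> k_gt0; rewrite -(exp1n k) ltn_exp2r.
have [h h2] : exists h : 'Z_(p ^ d), (h *+ 2 = 1)%R.
  by apply: Zp_half; rewrite ?pX_gt1 // oddX p_odd orbT.
have dv_nm := dvdn_exp2l p le_nm; have dv_dn := dvdn_exp2l p le_dn.
pose f := Zp_proj (pX_gt1 m m_gt0) (pX_gt1 n n_gt0) dv_nm.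
pose g := Zp_proj (pX_gt1 n n_gt0) (pX_gt1 d d_gt0) dv_dn.
exists (heis f g h), (heis_nearring f g h); split.
  exact/heis_local/Zp_pexp_nonunit_zmod.
exact: heis_isoGrp h2.
Qed.
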